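(* The prepare-and-measure certified deletion scheme described in the context has ciphertext indistinguishability: for every distinguishing attack $(A_0,A_1)$ there exists a negligible function $\eta$ such that for all $\lambda\in\mathbb N^+$, $$\mathbb E_{b}\,\mathbb E_{\mathsf k}\,\mathrm{Tr}\big[\,|b\rangle\langle b|\;A_{1}\circ(\Phi^{\mathrm{enc}}_{\mathsf k,b}\otimes\mathbb 1_S)\circ A_{0}(1)\big]\le\frac12+\eta(\lambda),$$ where $b$ is uniform in $\{0,1\}$ and $\mathsf k$ is a key distributed according to the key generation procedure.
   Context: Notation. $\mathcal Q(j)=(\mathbb C^2)^{\otimes j}$; $\mathcal D(\mathcal H)$ is the set of density operators on $\mathcal H$; $\omega$ is Hamming weight; $x|_{\mathcal J}$ is the restriction of a string $x$ to the positions in $\mathcal J$. $\mathsf H$ is the one-qubit Hadamard operator, and for $r,\theta\in\{0,1\}^m$, $|r^\theta\rangle=\mathsf H^{\theta_1}|r_1\rangle\otimes\cdots\otimes\mathsf H^{\theta_m}|r_m\rangle$. A function $\eta:\mathbb N\to\mathbb R_{\ge0}$ is negligible if for every positive polynomial $p$ there is $N$ with $\eta(\lambda)<1/p(\lambda)$ for all $\lambda>N$. A finite family $\mathfrak H$ of functions $\mathcal X\to\mathcal Z$ is universal$_2$ if for distinct $x,x'\in\mathcal X$ and $H$ uniform in $\mathfrak H$, $\Pr[H(x)=H(x')]\le 1/|\mathcal Z|$. Scheme. Fix an integer $n\ge1$. The positive integers $s,k,\tau,\mu$ are functions of the security parameter $\lambda\in\mathbb N^+$ (left implicit), $m=s+k$,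 and $\mu<s$. Let $\Theta=\{\theta\in\{0,1\}^m:\omega(\theta)=k\}$; for $\theta\in\Theta$ put $\mathcal I=\{i:\theta_i=0\}$ (size $s$) and $\bar{\mathcal I}=\{i:\theta_i=1\}$ (size $k$). $\mathfrak H_{\mathrm{pa}}$ is a universal$_2$ family of functions $\{0,1\}^s\to\{0,1\}^n$, $\mathfrak H_{\mathrm{ec}}$ is a universal$_2$ family of functions $\{0,1\}^s\to\{0,1\}^\tau$, and $\mathrm{synd}:\{0,1\}^s\to\{0,1\}^\mu$ is the syndrome function of a linear $[s,s-\mu]$ code. Key generation: sample independently and uniformly $\theta\in\Theta$, $r|_{\bar{\mathcal I}}\in\{0,1\}^k$, $u\in\{0,1\}^n$, $d\in\{0,1\}^\tau$, $e\in\{0,1\}^\mu$, $H_{\mathrm{pa}}\in\mathfrak H_{\mathrm{pa}}$, $H_{\mathrm{ec}}\in\mathfrak H_{\mathrm{ec}}$. The key is the classical tuple $\mathsf k=(r|_{\bar{\mathcal I}},\theta,u,d,e,H_{\mathrm{pa}},H_{\mathrm{ec}})$. Encryption of $\mathrm{msg}\in\{0,1\}^n$ under $\mathsf k$: sample $r|_{\mathcal I}\in\{0,1\}^s$ uniformly (which together with $r|_{\bar{\mathcal I}}$ defines $r\in\{0,1\}^m$), and output the state $|r^\theta\rangle\langle r^\theta|$ together with the classical strings $\mathrm{msg}\oplus H_{\mathrm{pa}}(r|_{\mathcal I})\oplus u$, $p=H_{\mathrm{ec}}(r|_{\mathcal I})\oplus d$, $q=\mathrm{synd}(r|_{\mathcal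 I})\oplus e$. Let $\Phi^{\mathrm{enc}}_{\mathsf k}$ be the resulting channel from the message space $\mathcal H_M=\mathcal Q(n)$ to the ciphertext space $\mathcal H_T$. Define $\Phi^{\mathrm{enc}}_{\mathsf k,0}$ as the channel on $\mathcal H_M$ that discards its input and outputs the encryption of the all-zero message $0^n$, and $\Phi^{\mathrm{enc}}_{\mathsf k,1}$ as the channel that measures its input in the computational basis and encrypts the outcome: $\rho\mapsto\sum_{a\in\{0,1\}^n}\langle a|\rho|a\rangle\,\Phi^{\mathrm{enc}}_{\mathsf k}(|a\rangle\langle a|)$. Distinguishing attack: for each $\lambda$, CPTP maps $A_0:\mathcal D(\mathbb C)\to\mathcal D(\mathcal H_M\otimes\mathcal H_S)$ and $A_1:\mathcal D(\mathcal H_T\otimes\mathcal H_S)\to\mathcal D(\mathcal Q(1))$, where $\mathcal H_S$ is a space of finitely many qubits (number depending on $\lambda$); the attacker is computationally unbounded. *)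

(* Defs.v *)
From HB Require Import structures.
From mathcomp Require Import all_boot all_order all_algebra.
From mathcomp Require Import complex mxtens reals.

Set Implicit Arguments.
Unset Strict Implicit.
Unset Printing Implicit Defensive.

Import Order.TTheory GRing.Theory Num.Theory.
Local Open Scope ring_scope.

(** * Bit strings *)

(* Strings are row vectors over F_2, so that [+] is the bitwise xor. *)
Notation bits l := ('rV['F_2]_l).

Definition hweight l (x : bits l) : nat := #|[set i | x 0 i != 0]|.

Definition positions l (theta : bits l) (b : 'F_2) : {set 'I_l} :=
  [set i | theta 0 i == b].

(* x|_J, the bits being listed by increasing position; only meaningful when
   j = #|J|. *)
Definition restrict l j (J : {set 'I_l}) (x : bits l) : bits j :=
  \row_(t < j) nth 0 [seq x 0 i | i <- enum J] t.

Definition bit_at l (x : bits l) (t : nat) : 'F_2 :=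
  oapp (fun i : 'I_l => x 0 i) 0 (insub t).

(* The string r such that r|_{theta = 0} = x and r|_{theta = 1} = y; see
   [restrict_merge_bits0] and [restrict_merge_bits1]. *)
Definition merge_bits l s k (theta : bits l) (x : bits s) (y : bits k) : bits l :=
  \row_(i < l) if theta 0 i == 0
               then bit_at x (index i (enum (positions theta 0)))
               else bit_at y (index i (enum (positions theta 1))).

Lemma F2_neq0 (b : 'F_2) : (b != 0) = (b == 1).
Proof. by case: b => [[|[|b]] //= ?]. Qed.

Lemma restrict_mergeE l j (J : {set 'I_l}) (r : bits l) (z : bits j) :
    (forall i, i \in J -> r 0 i = bit_at z (index i (enum J))) ->
  #|J| = j -> restrict j J r = z.
Proof.
move=> rJ Jj; apply/rowP => t; rewrite mxE.
have tJ : (t < size (enum J))%N by rewrite -cardE Jj.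
have [i0 _] : exists i0 : 'I_l, i0 \in J.
  by case: (enum J) (mem_enum J) tJ => [//|i e] eJ _; exists i;
     rewrite -eJ inE eqxx.
rewrite (nth_map i0) // rJ; last by rewrite -mem_enum mem_nth.
by rewrite index_uniq ?enum_uniq // /bit_at valK.
Qed.

Lemma card_positions1 l (theta : bits l) :
  #|positions theta 1| = hweight theta.
Proof. by apply: eq_card => i; rewrite !inE F2_neq0. Qed.

Lemma card_positions0 s k (theta : bits (s + k)) :
  hweight theta = k -> #|positions theta 0| = s.
Proof.
move=> wk; have := cardsC (positions theta 0).
rewrite card_ord; have -> : ~: positions theta 0 = positions theta 1.
  by apply/setP => i; rewrite !inE F2_neq0.
by rewrite card_positions1 wk => /addIn.
Qed.

Lemma restrict_merge_bits0 s k (theta : bits (s + k)) (x : bits s) (y : bits k) :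
  hweight theta = k -> restrict s (positions theta 0) (merge_bits theta x y) = x.
Proof.
move=> wk; apply: restrict_mergeE; last exact: card_positions0.
by move=> i; rewrite inE mxE => ->.
Qed.

Lemma restrict_merge_bits1 s k (theta : bits (s + k)) (x : bits s) (y : bits k) :
  hweight theta = k -> restrict k (positions theta 1) (merge_bits theta x y) = y.
Proof.
move=> wk; apply: restrict_mergeE; last by rewrite card_positions1.
by move=> i; rewrite inE mxE => /eqP ->.
Qed.

(** * Finite-dimensional quantum systems *)

(* A system of dimension d carries operators in 'M[R[i]]_d; the tensor product
   of systems is the Kronecker product [*t], and Q(j) has dimension 2 ^ j. *)

Section Quantum.
Variable R : realType.
Local Notation C := R[i].

Definition adjmx p q (A : 'M[C]_(p, q)) : 'M[C]_(q, p) := map_mx Num.conj A^T.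

(* <v|A|v> *)
Definition expval d (v : 'cV[C]_d) (A : 'M[C]_d) : C :=
  (adjmx v *m A *m v) 0 0.

Definition psdmx d (A : 'M[C]_d) : Prop := forall v : 'cV[C]_d, 0 <= expval v A.

(* The operator (1 (x) <i|) X (1 (x) |j>). *)
Definition subblock d k (X : 'M[C]_(d * k)) (i j : 'I_k) : 'M[C]_d :=
  \matrix_(a, b) X (mxtens_index (a, i)) (mxtens_index (b, j)).

(* Phi (x) 1, for a linear Phi; see [tens_idE]. *)
Definition tens_id d d' k (Phi : 'M[C]_d -> 'M[C]_d') (X : 'M[C]_(d * k)) :
    'M[C]_(d' * k) :=
  \sum_(i < k) \sum_(j < k) Phi (subblock X i j) *t delta_mx i j.

Lemma tens_idE d d' k (Phi : {linear 'M[C]_d -> 'M[C]_d'})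
    (A : 'M[C]_d) (B : 'M[C]_k) : tens_id Phi (A *t B) = Phi A *t B.
Proof.
apply/matrixP => u v; rewrite summxE.
case: (mxtens_indexP u) => a i; case: (mxtens_indexP v) => b j.
rewrite tensmxE /=.
have blk i' j' : subblock (A *t B) i' j' = B i' j' *: A.
  by apply/matrixP => a' b'; rewrite !mxE !mxtens_indexK mulrC.
under eq_bigr => i' _ do
  (rewrite summxE; under eq_bigr => j' _ do
     rewrite blk linearZ tensmxE /= !mxE -mulrA).
rewrite (bigD1 i) //= (bigD1 j) //= !eqxx mulr1.
rewrite !big1 ?addr0 1?mulrC // => [i' /negPf ni|j' /negPf nj].
  by apply: big1 => j' _; rewrite eq_sym ni mulr0 mulr0.
by rewrite [j == j']eq_sym nj andbF !mulr0.
Qed.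

Record cptp (d d' : nat) := CPTP {
  cptp_map :> {linear 'M[C]_d -> 'M[C]_d'};
  cptp_cp : forall (k : nat) (X : 'M[C]_(d * k)),
    psdmx X -> psdmx (tens_id cptp_map X);
  cptp_tp : forall X : 'M[C]_d, \tr (cptp_map X) = \tr X }.

Fixpoint tensvec j : ('I_j -> 'cV[C]_2) -> 'cV[C]_(2 ^ j) :=
  match j with
  | 0 => fun _ => 1%:M
  | j'.+1 => fun f =>
      castmx (esym (expnS 2 j'), erefl 1%N)
        (f ord0 *t tensvec (fun i => f (lift ord0 i)))
  end.

Definition ketbit (b : 'F_2) : 'cV[C]_2 := \col_i ((i : nat) == b)%:R.

Definition hadamard : 'M[C]_2 :=
  (sqrtC 2)^-1 *: \matrix_(i < 2, j < 2) (-1) ^+ (i * j).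

(* |r^theta> *)
Definition wiesner m (r theta : bits m) : 'cV[C]_(2 ^ m) :=
  tensvec (fun i => hadamard ^+ (theta 0 i : nat) *m ketbit (r 0 i)).

Definition ket j (x : bits j) : 'cV[C]_(2 ^ j) :=
  tensvec (fun i => ketbit (x 0 i)).

(* |v><v| *)
Definition proj d (v : 'cV[C]_d) : 'M[C]_d := v *m adjmx v.

Definition average (T : finType) (A : {set T}) (f : T -> C) : C :=
  #|A|%:R^-1 * \sum_(x in A) f x.

End Quantum.

(** * The certified deletion scheme *)

(* Members of the family are indexed by the nonempty finite type I, so a
   function may be listed several times. *)
Definition universal2 (I X Z : finType) (H : I -> X -> Z) : Prop :=
  (0 < #|I|)%N /\
  forall x x' : X, x != x' ->
    #|[set h | H h x == H h x']|%:R / #|I|%:R <= #|Z|%:R^-1 :> rat.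

(* Parameters at one value of the security parameter. The code is the kernel of
   a parity-check matrix of full rank mu, hence of dimension s - mu. *)
Record scheme (n : nat) := Scheme {
  sch_s : nat; sch_k : nat; sch_tau : nat; sch_mu : nat;
  sch_s_gt0 : (0 < sch_s)%N; sch_k_gt0 : (0 < sch_k)%N;
  sch_tau_gt0 : (0 < sch_tau)%N; sch_mu_gt0 : (0 < sch_mu)%N;
  sch_mu_lt_s : (sch_mu < sch_s)%N;
  Ipa : finType;
  Hpa : Ipa -> bits sch_s -> bits n;
  Hpa_universal2 : universal2 Hpa;
  Iec : finType;
  Hec : Iec -> bits sch_s -> bits sch_tau;
  Hec_universal2 : universal2 Hec;
  parity_check : 'M['F_2]_(sch_mu, sch_s);
  parity_check_rank : \rank parity_check = sch_mu }.

Section Encryption.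
Variables (n : nat) (S : scheme n) (R : realType).
Local Notation C := R[i].
Local Notation s := (sch_s S).
Local Notation k := (sch_k S).
Local Notation tau := (sch_tau S).
Local Notation mu := (sch_mu S).
Local Notation m := (s + k)%N.

Definition synd (x : bits s) : bits mu := x *m (parity_check S)^T.

Definition Theta : {set bits m} := [set theta | hweight theta == k].

Record key := Key {
  key_r : bits k; key_theta : bits m;
  key_u : bits n; key_d : bits tau; key_e : bits mu;
  key_pa : Ipa S; key_ec : Iec S }.

Definition average_key (f : key -> C) : C :=
  average Theta (fun theta =>
  average [set: bits k] (fun r =>
  average [set: bits n] (fun u =>
  average [set: bits tau] (fun d =>
  average [set: bits mu] (fun e =>
  average [set: Ipa S] (fun pa =>
  average [set: Iec S] (fun ec => f (Key r theta u d e pa ec)))))))).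

Definition dimM : nat := 2 ^ n.
Definition dimT : nat := 2 ^ m * 2 ^ n * 2 ^ tau * 2 ^ mu.

Definition encrypt (K : key) (msg : bits n) : 'M[C]_dimT :=
  #|{: bits s}|%:R^-1 *: \sum_(x : bits s)
    (proj (wiesner R (merge_bits (key_theta K) x (key_r K)) (key_theta K))
     *t proj (ket R (msg + Hpa (key_pa K) x + key_u K))
     *t proj (ket R (Hec (key_ec K) x + key_d K))
     *t proj (ket R (synd x + key_e K))).

(* Messages being classical, the channel reads its input in the computational
   basis. *)
Definition enc_channel (K : key) (rho : 'M[C]_dimM) : 'M[C]_dimT :=
  \sum_(a : bits n) expval (ket R a) rho *: encrypt K a.

Definition enc0 (K : key) (rho : 'M[C]_dimM) : 'M[C]_dimT :=
  \tr rho *: enc_channel K (proj (ket R 0)).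

Definition enc1 (K : key) (rho : 'M[C]_dimM) : 'M[C]_dimT :=
  \sum_(a : bits n) expval (ket R a) rho *: enc_channel K (proj (ket R a)).

Definition enc_b (b : 'F_2) : key -> 'M[C]_dimM -> 'M[C]_dimT :=
  if b == 0 then enc0 else enc1.

(* H_S consists of [side] qubits; A_0 starts from the one-dimensional system. *)
Record attack := Attack {
  side : nat;
  A0 : cptp R 1 (dimM * 2 ^ side);
  A1 : cptp R (dimT * 2 ^ side) (2 ^ 1) }.

(* Tr[|b><b| A_1 o (Phi_{K,b} (x) 1_S) o A_0 (1)] *)
Definition guess (A : attack) (b : 'F_2) (K : key) : C :=
  \tr (proj (ket R (const_mx b : bits 1)) *m
       A1 A (tens_id (enc_b b K) (A0 A 1%:M))).

End Encryption.

(* "Positive" polynomials are those positive at every positive integer. *)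
Definition negligible (R : realType) (eta : nat -> R) : Prop :=
  (forall l, 0 <= eta l) /\
  forall p : {poly R}, (forall l : nat, (0 < l)%N -> 0 < p.[l%:R]) ->
    exists N : nat, forall l : nat, (N < l)%N -> eta l < p.[l%:R]^-1.

(* Main.v *)
(* The one-time pad u makes the encryption, averaged over the key, independent
   of the message: replacing (msg, u) by (0, msg + u) does not change the
   ciphertext. So, on average over u, both channels discard their input and
   prepare the same ciphertext, and the attacker wins with probability exactly
   1/2: eta = 0 is a valid bound. *)
Require Import Defs.
From mathcomp Require Import all_boot all_order all_algebra.
From mathcomp Require Import complex mxtens reals.

Set Implicit Arguments.
Unset Strict Implicit.
Unset Printing Implicit Defensive.

Local Open Scope ring_scope.
Import Order.TTheory GRing.Theory Num.Theory.

Lemma card_bits l : #|{: bits l}| = (2 ^ l)%N.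
Proof. by rewrite card_mx mul1n card_Fp. Qed.

(** * Inner products, basis projectors and traces on tensor products *)

Section LinearAlgebra.
Variable R : realType.
Local Notation C := R[i].

Definition dotmx d (u v : 'cV[C]_d) : C := (adjmx u *m v) 0 0.

Lemma dotmxE d (u v : 'cV[C]_d) : dotmx u v = \sum_i (u i 0)^* * v i 0.
Proof. by rewrite /dotmx mxE; apply: eq_bigr => i _; rewrite !mxE. Qed.

Lemma adjmx_mul p q r (A : 'M[C]_(p, q)) (B : 'M[C]_(q, r)) :
  adjmx (A *m B) = adjmx B *m adjmx A.
Proof. by rewrite /adjmx trmx_mul map_mxM. Qed.

Lemma dotmx_tens p q (u u' : 'cV[C]_p) (v v' : 'cV[C]_q) :
  dotmx (u *t v) (u' *t v') = dotmx u u' * dotmx v v'.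
Proof.
rewrite !dotmxE mulr_sum; apply: eq_bigr => i _.
by rewrite !mxE !(ord1 (mxtens_unindex _).1) !(ord1 (mxtens_unindex _).2)
  rmorphM mulrACA.
Qed.

Lemma dotmx_cast p q (e : p = q) (u v : 'cV[C]_p) :
  dotmx (castmx (e, erefl 1%N) u) (castmx (e, erefl 1%N) v) = dotmx u v.
Proof. by case: q / e; rewrite !castmx_id. Qed.

Lemma dotmx_tensvec j (f g : 'I_j -> 'cV[C]_2) :
  dotmx (tensvec f) (tensvec g) = \prod_i dotmx (f i) (g i).
Proof.
elim: j f g => [|j IH] f g /=.
  by rewrite big_ord0 dotmxE big_ord1 !mxE conjC1 mulr1.
by rewrite big_ord_recl dotmx_cast dotmx_tens IH.
Qed.

Lemma dotmx_ketbit (a b : 'F_2) : dotmx (ketbit R a) (ketbit R b) = (a == b)%:R.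
Proof.
rewrite dotmxE !big_ord_recl big_ord0 !mxE.
by case: a b => [[|[|//]] ?] [[|[|//]] ?];
  rewrite /= ?conjC1 ?conjC0 !(mulr0, mulr1, mul0r, mul1r, addr0, add0r).
Qed.

(** The inner product factors over the positions; a position where the strings differ contributes a
    factor 0. *)
Lemma dotmx_ket j (x y : bits j) : dotmx (ket R x) (ket R y) = (x == y)%:R.
Proof.
rewrite dotmx_tensvec; under eq_bigr do rewrite dotmx_ketbit.
have [->|nxy] := eqVneq x y; first by rewrite big1 // => i _; rewrite eqxx.
have /existsP [i nxyi] : [exists i, x 0 i != y 0 i].
  apply: contraT => /existsPn exy; case/eqP: nxy.
  by apply/rowP => i; apply/eqP; move: (exy i); rewrite negbK.
by rewrite (bigD1 i) //= (negPf nxyi) mul0r.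
Qed.

Lemma hadamard_unitary : adjmx (hadamard R) *m hadamard R = 1%:M.
Proof.
have s2 : (sqrtC 2 : C)^-1 * (sqrtC 2)^-1 = 2^-1.
  by rewrite -invfM -expr2 sqrtCK.
have cs : ((sqrtC 2 : C)^-1)^* = (sqrtC 2)^-1.
  by apply: conj_Creal; rewrite ger0_real // invr_ge0 sqrtC_ge0.
have half2 : (2^-1 + 2^-1 : C) = 1.
  by rewrite -[2^-1]mul1r -mulrDl divff // (pnatr_eq0 _ 2).
apply/matrixP => i j; rewrite mxE !big_ord_recl big_ord0 !mxE !rmorphM /= cs.
rewrite !rmorph_sign addr0 [X in X + _]mulrACA [X in _ + X]mulrACA s2.
case: i j => [[|[|//]] ?] [[|[|//]] ?] //=;
by rewrite !(expr0, expr1, mulr1, mul1r, mulrN1, mulrNN, mulN1r, opprK)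
  ?half2 ?mulrN ?mulr1 ?subrr.
Qed.

Lemma dotmx_unitary d (U : 'M[C]_d) (u v : 'cV[C]_d) :
  adjmx U *m U = 1%:M -> dotmx (U *m u) (U *m v) = dotmx u v.
Proof.
by move=> UU; rewrite /dotmx adjmx_mul mulmxA -[adjmx u *m _ *m _]mulmxA UU mulmx1.
Qed.

Lemma dotmx_wiesner m (r theta : bits m) :
  dotmx (wiesner R r theta) (wiesner R r theta) = 1.
Proof.
rewrite dotmx_tensvec big1 // => i _.
case: (theta 0 i) => [[|[|//]] ?] /=.
  by rewrite expr0 mul1mx dotmx_ketbit eqxx.
by rewrite expr1 dotmx_unitary ?hadamard_unitary // dotmx_ketbit eqxx.
Qed.

Lemma mxtrace_proj d (v : 'cV[C]_d) : \tr (proj v) = dotmx v v.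
Proof. by rewrite mxtrace_mulC /mxtrace big_ord1. Qed.

Lemma mxtrace_tens p q (A : 'M[C]_p) (B : 'M[C]_q) :
  \tr (A *t B) = \tr A * \tr B.
Proof. by rewrite /mxtrace mulr_sum; apply: eq_bigr => i _; rewrite mxE. Qed.

Lemma mxtrace_delta d (i j : 'I_d) : \tr (delta_mx i j : 'M[C]_d) = (i == j)%:R.
Proof.
rewrite /mxtrace (bigD1 i) //= big1 => [|l /negPf li]; last by rewrite mxE li.
by rewrite mxE eqxx addr0.
Qed.

(** The kets are orthonormal and as many as the dimension, so the matrix [U] with these columns is
    square and has its adjoint as left inverse. That adjoint is then also a right inverse, which
    entrywise is the completeness relation. *)
Lemma sum_proj_ket j : \sum_(x : bits j) proj (ket R x) = 1%:M.
Proof.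
pose e (i : 'I_(2 ^ j)) : bits j := enum_val (cast_ord (esym (card_bits j)) i).
have e_inj : injective e by move=> i i' /enum_val_inj /cast_ord_inj.
have e_bij : bijective e by apply: inj_card_bij => //; rewrite card_bits card_ord.
pose U : 'M[C]_(2 ^ j) := \matrix_(a, b) ket R (e b) a 0.
have /mulmx1C <- : adjmx U *m U = 1%:M.
  apply/matrixP => a b; rewrite !mxE -(inj_eq e_inj) -dotmx_ket dotmxE.
  by apply: eq_bigr => c _; rewrite !mxE.
apply/matrixP => a b; rewrite summxE (reindex e) /=; last exact: onW_bij.
rewrite mxE; apply: eq_bigr => c _.
by rewrite /proj !mxE big_ord1 !mxE.
Qed.

Lemma expval_tr d (v : 'cV[C]_d) (X : 'M[C]_d) : expval v X = \tr (proj v *m X).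
Proof. by rewrite /proj -mulmxA mxtrace_mulC /mxtrace big_ord1. Qed.

Lemma sum_expval_ket j (X : 'M[C]_(2 ^ j)) :
  \sum_(x : bits j) expval (ket R x) X = \tr X.
Proof.
under eq_bigr do rewrite expval_tr.
by rewrite -raddf_sum -mulmx_suml sum_proj_ket mul1mx.
Qed.

Lemma eq_tens_id d d' k (Phi Psi : 'M[C]_d -> 'M[C]_d') (X : 'M[C]_(d * k)) :
  Phi =1 Psi -> tens_id Phi X = tens_id Psi X.
Proof.
by move=> eP; apply: eq_bigr => i _; apply: eq_bigr => j _; rewrite eP.
Qed.

(** Allows the sum over the pad to enter [tens_id], whose argument is a bare function such as
    [enc_b], with no linear structure declared. *)
Lemma tens_id_sum (I : finType) d d' k (Phi : I -> 'M[C]_d -> 'M[C]_d')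
    (X : 'M[C]_(d * k)) :
  tens_id (fun Y => \sum_u Phi u Y) X = \sum_u tens_id (Phi u) X.
Proof.
rewrite [RHS]exchange_big; apply: eq_bigr => i _.
rewrite [RHS]exchange_big; apply: eq_bigr => j _.
apply/matrixP => a b; rewrite summxE mxE summxE mulr_suml.
by apply: eq_bigr => u _; rewrite [RHS]mxE.
Qed.

(** Off-diagonal blocks are tensored with a traceless [delta_mx i j], so only the blocks
    [subblock X i i] count, and their traces add up to that of [X]. *)
Lemma mxtrace_tens_id d d' k (Phi : 'M[C]_d -> 'M[C]_d') (c : C)
    (X : 'M[C]_(d * k)) :
  (forall Y, \tr (Phi Y) = c * \tr Y) -> \tr (tens_id Phi X) = c * \tr X.
Proof.
move=> trPhi; rewrite raddf_sum /=.
transitivity (c * \sum_(i < k) \tr (subblock X i i)).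
  rewrite mulr_sumr; apply: eq_bigr => i _; rewrite raddf_sum /=.
  under eq_bigr do rewrite mxtrace_tens trPhi mxtrace_delta.
  rewrite (bigD1 i) //= eqxx mulr1 [X in _ + X]big1 ?addr0 // => j /negPf ji.
  by rewrite eq_sym ji mulr0.
congr (c * _); rewrite /mxtrace; under eq_bigr do under eq_bigr do rewrite mxE.
(* The double sum over block entries is the diagonal sum of [X] read through the index bijection of
   the tensor product. *)
rewrite exchange_big pair_big /= (reindex (@mxtens_unindex d k)) /=.
  by apply: eq_bigr => i _; rewrite -[(Ordinal _, _)]/(mxtens_unindex i) mxtens_unindexK.
by exists (@mxtens_index d k) => i _; [apply: mxtens_unindexK | apply: mxtens_indexK].
Qed.

End LinearAlgebra.

(** * Averages over finite sets *)

Section Average.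
Variable R : realType.
Local Notation C := R[i].

Lemma eq_average (T : finType) (A : {set T}) (f g : T -> C) :
  f =1 g -> average A f = average A g.
Proof. by move=> fg; congr (_ * _); apply: eq_bigr => x _; rewrite fg. Qed.

Lemma average_exchange (T U : finType) (A : {set T}) (B : {set U})
    (f : T -> U -> C) :
  average A (fun x => average B (f x)) = average B (fun y => average A (f^~ y)).
Proof.
rewrite /average; under eq_bigr do rewrite mulr_sumr.
rewrite exchange_big mulr_sumr mulr_sumr; apply: eq_bigr => y _.
by rewrite -mulr_sumr mulrCA.
Qed.

(** The average over the empty set is 0, which is where [0 <= c] enters. *)
Lemma average_le (T : finType) (A : {set T}) (f : T -> C) (c : C) :
  0 <= c -> (forall x, f x <= c) -> average A f <= c.
Proof.
move=> c0 fc; have [->|/set0Pn [x xA]] := eqVneq A set0.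
  by rewrite /average big_set0 mulr0.
have A_gt0 : 0 < #|A|%:R :> C by rewrite ltr0n card_gt0; apply/set0Pn; exists x.
rewrite /average mulrC ler_pdivrMr // mulr_natr -sumr_const.
by apply: ler_sum.
Qed.

End Average.

(** * Ciphertexts and guesses summed over the one-time pad *)

Section Scheme.
Variables (n : nat) (S : scheme n) (R : realType).
Local Notation C := R[i].

Lemma average_key_exchange (T : finType) (B : {set T}) (f : T -> key S -> C) :
  average B (fun b => average_key (f b)) =
  average_key (fun K => average B (f^~ K)).
Proof.
rewrite /average_key average_exchange; apply: eq_average => theta.
rewrite average_exchange; apply: eq_average => r.
rewrite average_exchange; apply: eq_average => u.
rewrite average_exchange; apply: eq_average => d.
rewrite average_exchange; apply: eq_average => e.
rewrite average_exchange; apply: eq_average => pa.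
by rewrite average_exchange; apply: eq_average.
Qed.

(** The key components are independent, so the average over [u] can be moved innermost and the
    others bounded pointwise. *)
Lemma average_key_le (f : key S -> C) (c : C) : 0 <= c ->
  (forall theta r d e pa ec,
     average [set: bits n] (fun u => f (Key r theta u d e pa ec)) <= c) ->
  average_key f <= c.
Proof.
move=> c0 fc; rewrite /average_key.
apply: average_le => // theta; apply: average_le => // r.
rewrite average_exchange; apply: average_le => // d.
rewrite average_exchange; apply: average_le => // e.
rewrite average_exchange; apply: average_le => // pa.
by rewrite average_exchange; apply: average_le => // ec.
Qed.

Lemma mxtrace_encrypt (K : key S) (msg : bits n) :
  \tr (encrypt R K msg) = 1.
Proof.
rewrite mxtraceZ raddf_sum /=.
under eq_bigr do
  rewrite !mxtrace_tens !mxtrace_proj dotmx_wiesner !dotmx_ket !eqxx !mulr1.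
by rewrite sumr_const mulVf // pnatr_eq0 card_bits expn_eq0.
Qed.

Section FixedKey.
Variables (theta : bits (sch_s S + sch_k S)) (r : bits (sch_k S)).
Variables (d : bits (sch_tau S)) (e : bits (sch_mu S)).
Variables (pa : Ipa S) (ec : Iec S).
Let K (u : bits n) : key S := Key r theta u d e pa ec.
Let ciphertext_sum : 'M[C]_(dimT S) := \sum_u encrypt R (K u) 0.

(** Message and pad enter each ciphertext term only through their sum. *)
Lemma encrypt_shift (u a : bits n) : encrypt R (K u) a = encrypt R (K (a + u)) 0.
Proof.
by congr (_ *: _); apply: eq_bigr => x _ /=; rewrite add0r addrCA addrA.
Qed.

Lemma sum_encrypt (a : bits n) : \sum_u encrypt R (K u) a = ciphertext_sum.
Proof.
rewrite /ciphertext_sum [RHS](reindex (+%R a)) /=.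
  by apply: eq_bigr => u _; rewrite encrypt_shift.
by apply: onW_bij; exists (+%R (- a)) => u; rewrite (addKr, addNKr).
Qed.

(** Once the pad is summed out, every outcome [a] yields the same operator, and the outcome weights
    add up to the trace of [rho]. *)
Lemma sum_enc_channel (rho : 'M[C]_(dimM n)) :
  \sum_u enc_channel (K u) rho = \tr rho *: ciphertext_sum.
Proof.
rewrite exchange_big -sum_expval_ket scaler_suml; apply: eq_bigr => a _.
by rewrite -scaler_sumr sum_encrypt.
Qed.

Lemma sum_enc_b (b : 'F_2) (rho : 'M[C]_(dimM n)) :
  \sum_u enc_b b (K u) rho = \tr rho *: ciphertext_sum.
Proof.
have tr_ket (a : bits n) : \tr (proj (ket R a)) = 1.
  by rewrite mxtrace_proj dotmx_ket eqxx.
rewrite /enc_b; case: (b == 0).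
  by rewrite -scaler_sumr sum_enc_channel tr_ket scale1r.
rewrite exchange_big -sum_expval_ket scaler_suml; apply: eq_bigr => a _.
by rewrite -scaler_sumr sum_enc_channel tr_ket scale1r.
Qed.

Lemma sum_guess (A : attack S R) :
  \sum_u (guess A 0 (K u) + guess A 1 (K u)) = #|{: bits n}|%:R.
Proof.
(* By linearity of [A1] and of the trace, the sum over the pad moves onto the channel; the resulting
   attacker input [Y] does not depend on [b]. *)
pose Y := tens_id (fun rho : 'M[C]_(dimM n) => \tr rho *: ciphertext_sum)
  (A0 A 1%:M).
have guess_sum b :
    \sum_u guess A b (K u) = \tr (proj (ket R (const_mx b : bits 1)) *m A1 A Y).
  rewrite -raddf_sum -mulmx_sumr -raddf_sum -tens_id_sum /=.
  by congr (\tr (_ *m A1 A _)); apply: eq_tens_id => rho; apply: sum_enc_b.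
rewrite big_split /= !guess_sum -raddfD -mulmxDl /=.
(* The two winning projectors resolve the identity, so the total is the trace of [A1 A Y], preserved
   by [A1]. *)
have -> : proj (ket R (const_mx 0 : bits 1)) + proj (ket R (const_mx 1)) = 1%:M.
  rewrite -sum_proj_ket (reindex (fun b : 'F_2 => const_mx b : bits 1)) /=.
    rewrite !big_ord_recl big_ord0 addr0.
    by congr (proj (ket R (const_mx _)) + proj (ket R (const_mx _)));
      apply: val_inj.
  apply: onW_bij; exists (fun x : bits 1 => x 0 0) => x; first by rewrite mxE.
  by apply/rowP => i; rewrite mxE ord1.
(* Each encryption has trace 1, so [ciphertext_sum] has as trace the number of pads. *)
rewrite mul1mx cptp_tp (mxtrace_tens_id (c := \tr ciphertext_sum)) => [|rho].
  rewrite cptp_tp mxtrace1 mulr1 raddf_sum /=.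
  under eq_bigr do rewrite mxtrace_encrypt.
  by rewrite sumr_const.
by rewrite mxtraceZ mulrC.
Qed.

End FixedKey.
End Scheme.

(* The value of Sch and A at 0 plays no role. The inequality is in the order of
   R[i], which also asserts that the left-hand side is real. *)
Theorem theorem1 (R : realType) (n : nat) (n_gt0 : (0 < n)%N)
    (Sch : nat -> scheme n) (A : forall l : nat, attack (Sch l) R) :
  exists eta : nat -> R, negligible eta /\
    forall l : nat, (0 < l)%N ->
      average [set: 'F_2]
        (fun b => average_key (fun K => guess (A l) b K))
      <= 2^-1 + (eta l)%:C%C.
Proof.
exists (fun=> 0); split.
  (* With [N = 0], the range [N < l] is exactly where [p] is assumed positive. *)
  split=> // p p_gt0; exists 0%N => l l_gt0.
  by rewrite invr_gt0 p_gt0.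
move=> l _; rewrite addr0 average_key_exchange.
apply: average_key_le => [|theta r d e pa ec]; first by rewrite invr_ge0.
(* With the rest of the key fixed, pulling the average over [b] back out exposes the factor [2^-1];
   what remains, the average over [u] of the two guesses added, will equal 1. *)
rewrite average_exchange {1}/average cardsT card_Fp //.
rewrite (eq_bigl xpredT) => [|b]; last by rewrite inE.
rewrite !big_ord_recl big_ord0 addr0.
(* ['F_2] was enumerated as an ordinal type, so its second element appears as [lift ord0 ord0]. *)
have -> : lift ord0 ord0 = 1 :> 'F_2 by apply: val_inj.
rewrite -[ord0]/(0 : 'F_2) /average -mulrDr -!big_split /=.
rewrite (eq_bigl xpredT) => [|u]; last by rewrite inE.
rewrite sum_guess cardsT mulVf ?mulr1 //.
by rewrite pnatr_eq0 card_bits expn_eq0.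
Qed.
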